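(* Let $T:[0,1]\to[0,1]$ be a piecewise affine and expanding, transitive Markov map with $N$ atoms, and for $0<\gamma<1$ let $$\phi_\gamma=\sum_{k=0}^{+\infty}\gamma^k T^{k+1}:[0,1]\to\mathbb{R}.$$ Then: (i) for every $\gamma\in(0,1)$ with $e^{h_{\mathrm{top}}(T)}\gamma<1$, the total variation of $\phi_\gamma$ on $[0,1]$ is finite; (ii) for all $\gamma\in(0,1)$ with $e^{h_{\mathrm{top}}(T)}\gamma>1$, except for at most $2N-1$ values of $\gamma$, the total variation of $\phi_\gamma$ on $[0,1]$ is infinite.
   Context: $T^k$ denotes the $k$-th iterate of $T$ under composition. A piecewise affine Markov map of the interval is a map $T:[0,1]\to[0,1]$ (not necessarily continuous) for which there are points $0=c_0<c_1<\dots<c_N=1$ such that, with $I_i=(c_{i-1},c_i)$, $i=1,\dots,N$ (the atoms), the restriction of $T$ to each $I_i$ is affine with nonzero slope $s_i$, and, for all $i,j$, if $T(I_i)\cap I_j\neq\emptyset$ then $T(I_i)\supset I_j$. It is expanding if $|s_i|>1$ for all $i$. Its transition matrix is the $N\times N$ matrix $M$ with $M_{ij}=1$ if $T(I_i)\supset I_j$ and $M_{ij}=0$ otherwise; $T$ is transitive if $M$ is irreducible. The topological entropy of $T$ is $h_{\mathrm{top}}(T)=\lim_{k\to+\infty}\frac{\log n_k}{k}$, where $n_k$ is the number of affine branches of $T^k$, i.e. the number of nonempty sets $\bigcap_{l=0}^{k-1}T^{-l}(I_{i_l})$, $i_0,\dots,i_{k-1}\in\{1,\dots,N\}$; equivalently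 $e^{h_{\mathrm{top}}(T)}$ is the spectral radius of $M$. The total variation of $\phi$ on $[0,1]$ is the supremum of $\sum_{i=1}^{n-1}|\phi(x_{i+1})-\phi(x_i)|$ over all finite subdivisions $0=x_1<\dots<x_n=1$. *)

(* Defs.v *)
From HB Require Import structures.
From mathcomp Require Import all_boot all_order all_algebra.
From mathcomp Require Import all_classical all_reals all_analysis.

Set Implicit Arguments.
Unset Strict Implicit.
Unset Printing Implicit Defensive.

Import Order.TTheory GRing.Theory Num.Theory.
Import numFieldNormedType.Exports.

Local Open Scope classical_set_scope.
Local Open Scope ring_scope.

Section MarkovMaps.
Context {R : realType}.

(* A map of [0,1] is represented by a map T : R -> R sending [0,1] to itself;
   its values outside [0,1] are irrelevant.  Likewise only the breakpoints
   c 0 < c 1 < ... < c N are meaningful.  The atom written (c_{i-1}, c_i) with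
   i = 1, ..., N is indexed here by i.-1 : 'I_N. *)
Definition atom (N : nat) (c : nat -> R) (i : 'I_N) : set R :=
  `]c i, c i.+1[%classic.

Record affine_markov_map (N : nat) (c : nat -> R) (s : 'I_N -> R)
    (T : R -> R) : Prop := AffineMarkovMap {
  amm_maps : forall x, `[0, 1]%classic x -> `[0, 1]%classic (T x) ;
  amm_first : c 0%N = 0 ;
  amm_last : c N = 1 ;
  amm_incr : forall i : 'I_N, c i < c i.+1 ;
  amm_affine : forall i : 'I_N,
    exists b : R, forall x, atom c i x -> T x = s i * x + b ;
  amm_slope : forall i : 'I_N, s i != 0 ;
  amm_markov : forall i j : 'I_N,
    (T @` atom c i) `&` atom c j !=set0 -> atom c j `<=` T @` atom c i }.

Definition expanding (N : nat) (s : 'I_N -> R) : Prop :=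
  forall i : 'I_N, 1 < `|s i|.

Definition transition_matrix (N : nat) (c : nat -> R) (T : R -> R) : 'M[R]_N :=
  \matrix_(i, j) (`[< atom c j `<=` T @` atom c i >])%:R.

(* Irreducibility in the Perron-Frobenius sense, for matrices with nonnegative
   entries. *)
Definition irreducible_mx (N : nat) (M : 'M[R]_N) : Prop :=
  forall i j : 'I_N, exists2 k : nat, (0 < k)%N & 0 < (M ^+ k) i j.

Definition transitive_map (N : nat) (c : nat -> R) (T : R -> R) : Prop :=
  irreducible_mx (transition_matrix N c T).

Definition cylinder (N : nat) (c : nat -> R) (T : R -> R) (k : nat)
    (w : k.-tuple 'I_N) : set R :=
  [set x | forall l : 'I_k, atom c (tnth w l) (iter l T x)].

(* Cylinders of distinct words are disjoint, so counting the words with a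
   nonempty cylinder is counting the nonempty cylinders. *)
Definition num_branches (N : nat) (c : nat -> R) (T : R -> R) (k : nat) : nat :=
  #|[set w : k.-tuple 'I_N | `[< cylinder c T w !=set0 >]]%SET|.

Definition htop (N : nat) (c : nat -> R) (T : R -> R) : R :=
  limn (fun k : nat => ln (num_branches N c T k)%:R / k%:R).

Definition phi (T : R -> R) (gamma x : R) : R :=
  limn (series (fun k : nat => gamma ^+ k * iter k.+1 T x)).

End MarkovMaps.

(* Main.v *)
Require Import Defs.
From HB Require Import structures.
From mathcomp Require Import all_boot all_order all_algebra.
From mathcomp Require Import all_classical all_reals all_analysis.
From mathcomp Require Import perm zify ring lra.

Set Implicit Arguments.
Unset Strict Implicit.
Unset Printing Implicit Defensive.

Import Order.TTheory GRing.Theory Num.Theory.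
Import numFieldNormedType.Exports.

Local Open Scope classical_set_scope.
Local Open Scope ring_scope.

(** Write phi for phi_gamma and M for the transition matrix. The series gives
    phi = T + gamma * (phi o T), so on the atom I_i, where T x = s_i x + b_i,
    phi is an affine function plus gamma times a rescaled copy of the
    restriction of phi to T(I_i), and T(I_i) consists of the atoms I_j with
    M_ij = 1 and of breakpoints between them. Everything follows from this
    self-similarity and from the count n_(k+1) = sum_ij (M^k)_ij
    ([num_branchesS]). As n_k is submultiplicative, Fekete's lemma ([fekete])
    makes the limit defining the entropy exist; hence gamma^k n_k decays
    geometrically if e^h gamma < 1 ([submult_decay]) and is unbounded if
    e^h gamma > 1 ([submult_unbounded]).

    Finite variation. Let v_K(i) be the variation on I_i of the sum of the
    first K terms of phi. Crossing a breakpoint costs a bounded amount, so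
    v_(K+1) <= 1 + gamma M (v_K + const), and v_K is bounded by the sums of
    gamma^l M^l 1, that is by the convergent series of gamma^l n_(l+1)
    ([phi_bounded_variation]).

    Infinite variation. Measure the failure of affinity of phi over an interval
    by sums, over disjoint triples x < y < z, of the distance between phi y and
    its linear interpolation from x and z. This is at most the variation,
    ignores affine summands, and is invariant under affine changes of variable.
    A positive defect delta in I_j is pulled back to every cylinder ending in
    I_j, which gives the defect gamma^n (M^n)_ij delta in I_i
    ([phi_defect_growth]). By irreducibility these numbers are unbounded if
    e^h gamma > 1. So if phi has finite variation, it is affine on each atom
    ([phi_defect0]), and the affine formulas agree on all the atoms of T(I_i)
    ([affine_pieces]).

    It remains to bound the number of gamma for which this happens. Extend the
    affine pieces to the 2N ends of the atoms. T maps ends to ends, so the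
    values U at the ends solve the linear system
    U_a = e(g a) + gamma U_(g a), where g is the induced self-map of the ends
    and e the position. By Cramer's rule the components of U, and all fixed
    linear combinations of them, are polynomials in gamma of degree at most
    2N - 1 over the common denominator det(1 - gamma g)
    ([orbit_series_cramer]). Affinity on T(I_i) makes one such combination
    vanish, namely the deviation of three ends of atoms of T(I_i) from lying on
    a line. So at most 2N - 1 values of gamma are exceptional, unless the
    numerators vanish identically for all i ([linear_relation_finite]). In that
    case the coefficients vanish too: for every k, the positions under g^k of
    those three ends are affinely related to the ends themselves. By induction
    on k the images under g^k of the two ends of an atom are then at distance
    at least (min |s|)^k times the length of the atom, which is absurd in [0,1]
    ([bend_nonzero]). *)

(** * Growth rate of submultiplicative sequences *)

Section Growth.
Context {R : realType}.

(** Euclidean division n = q m + r gives a n <= q a m + a r, so a n / n is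
    eventually at most a m / m + e, for an m at which a m / m is close to its
    infimum. *)
Lemma fekete (a : nat -> R) :
  (forall k, 0 <= a k) -> (forall k l, a (k + l)%N <= a k + a l) ->
  cvgn (fun k => a k / k%:R).
Proof.
move=> a_ge0 a_sub.
(* Index shifted by one: at 0 the quotient is 0 by convention. *)
pose A := [set a k.+1 / k.+1%:R | k in [set: nat]].
have A_lb : has_lbound A.
  by exists 0 => _ [k _ <-]; apply: divr_ge0.
have A0 : A !=set0 by exists (a 1%N / 1); exists 0%N.
have infA k : inf A <= a k.+1 / k.+1%:R by apply: ge_inf => //; exists k.
have a_mul q m : a (q * m)%N <= q%:R * a m + a 0%N.
  elim: q => [|q IH]; first by rewrite mul0n mul0r add0r.
  rewrite mulSn -natr1 mulrDl mul1r; apply: le_trans (a_sub _ _) _.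
  by move: IH; lra.
apply: (@cvgP _ _ (inf A)); apply/cvgrPdist_lt => /= e e0.
have [_ [m _ <-] am] : exists2 x, A x & x < inf A + e / 2.
  by apply: inf_adherent => //; lra.
set K := \sum_(r < m.+1) a r + a 0%N.
have K0 : 0 <= K by rewrite addr_ge0 ?sumr_ge0.
near=> n.
have n0 : (0 < n)%N by near: n; exists 1%N.
have nR0 : 0 < n%:R :> R by rewrite ltr0n.
have Kn : K / n%:R < e / 2.
  rewrite ltr_pdivrMr// mulrC -ltr_pdivrMr; last lra.
  near: n; exact: nbhs_infty_gtr.
have low : inf A <= a n / n%:R by case: (n) n0 => // ? _; exact: infA.
suff up : a n / n%:R <= a m.+1 / m.+1%:R + K / n%:R.
  move: low up Kn am; move: (a n / _) (a m.+1 / _) (K / _) (inf A) => x y z w.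
  by rewrite ltr_distl => *; apply/andP; split; lra.
have nE := divn_eq n m.+1.
have rem : a (n %% m.+1)%N <= \sum_(r < m.+1) a r.
  rewrite (bigD1 (Ordinal (ltn_pmod n (ltn0Sn m))))//= lerDl.
  by apply: sumr_ge0.
have step : a n <= (n %/ m.+1)%:R * a m.+1 + K.
  rewrite {1}nE; apply: le_trans (a_sub _ _) _.
  by rewrite /K addrCA addrC lerD// addrC.
have quo : (n %/ m.+1)%:R <= n%:R / m.+1%:R :> R.
  by rewrite ler_pdivlMr ?ltr0n// -natrM ler_nat leq_trunc_div.
rewrite ler_pdivrMr// mulrDl [K / _ * _]divfK ?gt_eqF//.
apply: le_trans step _; rewrite lerD2r mulrAC -mulrA [leRHS]mulrC.
exact: ler_wpM2r.
Unshelve. all: by end_near. Qed.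

Variable u : nat -> R.
Hypothesis u_ge1 : forall k, 1 <= u k.
Hypothesis u_sub : forall k l, u (k + l)%N <= u k * u l.

Let rate := limn (fun k => ln (u k) / k%:R).

Let u_gt0 k : 0 < u k. Proof. exact: lt_le_trans (u_ge1 k). Qed.

Let rate_cvg : (fun k => ln (u k) / k%:R) @ \oo --> rate.
Proof.
apply: fekete => [k|k l]; first by rewrite ln_ge0.
by rewrite -lnM ?posrE// ler_ln ?posrE ?mulr_gt0.
Qed.

(** Eventually ln (u k) / k < rate + d, with 2 d = - (rate + ln g); hence
    r = exp (- d). The finitely many other terms are absorbed in C. *)
Lemma submult_decay (g : R) : 0 < g -> expR rate * g < 1 ->
  exists C r, [/\ 0 <= C, 0 < r, r < 1 & forall k, g ^+ k * u k <= C * r ^+ k].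
Proof.
move=> g0 rg.
have lg : rate + ln g < 0.
  by rewrite -(expRK rate) -lnM ?posrE ?expR_gt0// ln_lt0// mulr_gt0 ?expR_gt0.
set d := - (rate + ln g) / 2.
have d0 : 0 < d by rewrite /d; lra.
pose r := expR (- d).
have r0 : 0 < r by rewrite expR_gt0.
have r1 : r < 1 by rewrite expR_lt1; lra.
have [K _ HK] : \forall k \near \oo, ln (u k) / k%:R < rate + d.
  by apply: (cvgr_lt _ rate_cvg); lra.
exists (1 + \sum_(k < K.+1) g ^+ k * u k / r ^+ k), r; split => //.
  apply: addr_ge0 => //; apply: sumr_ge0 => k _.
  by rewrite divr_ge0 ?mulr_ge0 ?exprn_ge0 ?ltW.
move=> k; have rk0 : 0 < r ^+ k by rewrite exprn_gt0.
rewrite -ler_pdivrMr//; have [kK|Kk] := ltnP k K.+1.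
  rewrite (bigD1 (Ordinal kK))//= addrCA lerDl addr_ge0//.
  by apply: sumr_ge0 => j _; rewrite divr_ge0 ?mulr_ge0 ?exprn_ge0 ?ltW.
apply: (@le_trans _ _ 1); last first.
  rewrite lerDl; apply: sumr_ge0 => j _.
  by rewrite divr_ge0 ?mulr_ge0 ?exprn_ge0 ?ltW.
have k0 : 0 < k%:R :> R by rewrite ltr0n; exact: leq_ltn_trans Kk.
rewrite ler_pdivrMr// mul1r.
rewrite -(@lnK _ (g ^+ k * u k)) ?posrE ?mulr_gt0 ?exprn_gt0//.
rewrite /r -expRM_natl ler_expR lnM ?posrE ?exprn_gt0// lnXn//.
have := HK k (ltnW Kk); rewrite ltr_pdivrMr// => uk.
rewrite -[ln g *+ k]mulr_natl -lerBrDl; apply: le_trans (ltW uk) _.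
rewrite (_ : rate + d = - d - ln g); last by rewrite /d; lra.
by rewrite mulrC mulrBr.
Qed.

Lemma submult_unbounded (g : R) : 0 < g -> 1 < expR rate * g ->
  forall B, exists k, B < g ^+ k * u k.
Proof.
move=> g0 rg B.
have lg : 0 < rate + ln g.
  by rewrite -(expRK rate) -lnM ?posrE ?expR_gt0// ln_gt0.
set d := (rate + ln g) / 2.
have d0 : 0 < d by rewrite /d; lra.
near \oo => k; exists k.
have k0 : 0 < k%:R :> R by rewrite ltr0n; near: k; exists 1%N.
have uk : rate - d < ln (u k) / k%:R.
  near: k; apply: (cvgr_gt _ rate_cvg); lra.
have Bk : B < k%:R * d.
  rewrite -ltr_pdivrMr//; near: k; exact: nbhs_infty_gtr.
apply: lt_le_trans Bk _.
rewrite -(@lnK _ (g ^+ k * u k)) ?posrE ?mulr_gt0 ?exprn_gt0//.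
rewrite lnM ?posrE ?exprn_gt0// lnXn//.
have le1 : k%:R * d <= ln g *+ k + ln (u k).
  move: uk; rewrite ltr_pdivlMr// => uk.
  rewrite -[ln g *+ k]mulr_natl -lerBlDl -mulrBr; apply: le_trans (ltW uk).
  by rewrite mulrC ler_pM2r// /d; lra.
apply: le_trans le1 _; apply: le_trans (expR_ge1Dx _); lra.
Unshelve. all: by end_near. Qed.

End Growth.

(** * Orbit series of a self-map of a finite set *)

Section Cramer.
Context {R : realType}.

Lemma size_det_affine n (B : 'M[{poly R}]_n) :
  (forall i j, (size (B i j) <= 2)%N) -> (size (\det B) <= n.+1)%N.
Proof.
move=> B2; rewrite /determinant; apply: (leq_trans (size_sum _ _ _)).
apply/bigmax_leqP => s _; rewrite mulr_sign.
rewrite (fun_if (fun p : {poly R} => size p)) size_polyN if_same.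
apply: (leq_trans (size_prod_leq _ _)); rewrite cardT size_enum_ord.
have : (\sum_(i < n) size (B i (s i)) <= \sum_(i < n) 2)%N.
  by apply: leq_sum => i _.
rewrite sum_nat_const card_ord leq_subLR => le_sum.
by apply: (@leq_trans (n * 2).+1) => //; lia.
Qed.

(** The formal series sum_k X^k xi(g^k a) is rational: it solves
    (1 - X G) V = xi, with G the 0/1 matrix of g. Thus
    D = det (1 - X G), and A is the vector adj(1 - X G) xi, whose entries are
    combinations of minors of size #|S| - 1: this is the source of the degree
    bound. At a value of gamma where D vanishes the last property still holds,
    so no such value has to be excluded. *)
Lemma orbit_series_cramer (S : finType) (g : S -> S) (xi : S -> R) :
  exists (D : {poly R}) (A : S -> {poly R}),
  [/\ D`_0 = 1, forall a, (size (A a) <= #|S|)%N,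
      forall a, A a = D * (xi a)%:P + 'X * A (g a) &
      forall (gamma : R) U, (forall a, U a = xi a + gamma * U (g a)) ->
        forall a, (A a).[gamma] = D.[gamma] * U a].
Proof.
pose gr (i : 'I_#|S|) := enum_rank (g (enum_val i)).
pose B : 'M[{poly R}]_#|S| :=
  1%:M - 'X *: \matrix_(i, j) (gr i == j)%:R.
pose col f : 'cV[{poly R}]_#|S| := \col_i (f (enum_val i))%:P.
pose A := \adj B *m col xi.
have mulB (V : 'cV[{poly R}]_#|S|) i :
    (B *m V) i 0 = V i 0 - 'X * V (gr i) 0.
  rewrite /B mulmxBl mul1mx -scalemxAl !mxE; congr (_ - 'X * _).
  rewrite (bigD1 (gr i))//= !mxE eqxx mul1r big1 ?addr0// => j ji.
  by rewrite !mxE eq_sym (negbTE ji) mul0r.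
exists (\det B), (fun a => A (enum_rank a) 0); split.
- rewrite -horner_coef0 -[_.[0]]/(horner_eval 0 _) -det_map_mx.
  rewrite (_ : map_mx _ _ = 1%:M) ?det1//; apply/matrixP => i j.
  rewrite !mxE /= /horner_eval hornerD hornerN hornerM hornerX mul0r subr0.
  by rewrite -polyC_natr hornerC.
- move=> a; rewrite !mxE; apply: (leq_trans (size_sum _ _ _)).
  apply/bigmax_leqP => j _; rewrite !mxE mulrC mul_polyC.
  apply: (leq_trans (size_scale_leq _ _)).
  rewrite /cofactor -signr_odd mulr_sign.
  rewrite (fun_if (fun p : {poly R} => size p)) size_polyN if_same.
  have S0 : (0 < #|S|)%N by rewrite -[#|S|]card_ord; apply/card_gt0P; exists j.
  rewrite -[leqRHS](prednK S0); apply: size_det_affine => k l; rewrite !mxE.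
  apply: (leq_trans (size_polyD _ _)); rewrite geq_max size_polyN.
  rewrite -!polyC_natr; apply/andP; split.
    exact: leq_trans (size_polyC_leq1 _) _.
  by rewrite mulrC mul_polyC (leq_trans (size_scale_leq _ _))// size_polyX.
- move=> a; have := mulB A (enum_rank a).
  rewrite /A mulmxA mul_mx_adj mul_scalar_mx !mxE /gr enum_rankK.
  by move/eqP; rewrite eq_sym subr_eq => /eqP.
move=> gamma U hU a.
(* xi = (1 - X G) U + (X - gamma) (U o g), and the last term vanishes at
   gamma. *)
have -> : A = \det B *: col U
      + ('X - gamma%:P) *: (\adj B *m col (U \o g)).
  rewrite -mul_scalar_mx -mul_adj_mx -mulmxA scalemxAr -mulmxDr /A.
  congr (_ *m _); apply/colP => i; rewrite [RHS]mxE mulB !mxE /= /gr enum_rankK.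
  rewrite (hU (enum_val i)) polyCD polyCM; ring.
by rewrite !mxE enum_rankK !hornerE subrr mul0r addr0.
Qed.

(** A duplicate-free list of roots of maximal length contains them all. *)
Lemma poly_root_seq (p : {poly R}) : p != 0 ->
  exists E : seq R, (size E < size p)%N /\ forall x, root p x -> x \in E.
Proof.
move=> p0.
pose P n := `[< exists E : seq R, [/\ uniq E, all (root p) E & size E = n] >].
have exP : exists n, P n by exists 0%N; apply/asboolP; exists [::].
have ubP n : P n -> (n <= size p)%N.
  by move=> /asboolP[E [uE rE <-]]; exact/ltnW/max_poly_roots.
case: (ex_maxnP exP ubP) => _ /asboolP[E [uE rE <-]] maxE.
exists E; split; first exact: max_poly_roots.
move=> x rx; apply/negPn/negP => xE.
have /maxE : P (size E).+1 by apply/asboolP; exists (x :: E) => /=; rewrite xE uE rx rE.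
by rewrite ltnn.
Qed.

(** The relation w between the components of U forces gamma to be a root of
    the corresponding combination F 0 of the numerators. If F 0 were the zero
    polynomial, reading off constant terms and dividing by X would show that w
    also annihilates all the coefficient vectors xi o g^n, n = 0, 1, 2, ... *)
Lemma linear_relation_finite (S : finType) (g : S -> S) (xi : S -> R)
    (w : seq (R * S)) (k : nat) :
  \sum_(p <- w) p.1 * xi (iter k g p.2) != 0 ->
  exists E : seq R, (size E <= #|S| - 1)%N /\
    forall (gamma : R) U, (forall a, U a = xi a + gamma * U (g a)) ->
      \sum_(p <- w) p.1 * U p.2 = 0 -> gamma \in E.
Proof.
move=> wk.
have [D [A [D0 sA Arec Aval]]] := orbit_series_cramer g xi.
pose F n := \sum_(p <- w) p.1%:P * A (iter n g p.2).
have Frec n : F n =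
    D * (\sum_(p <- w) p.1 * xi (iter n g p.2))%:P + 'X * F n.+1.
  rewrite /F rmorph_sum !mulr_sumr -big_split/=; apply: eq_bigr => p _.
  by rewrite Arec polyCM; ring.
have F_neq0 : F 0%N != 0.
  apply: contra_neq wk => F0; have Fn n : F n = 0.
    elim: n => // n IH; move: (IH); rewrite Frec => /(congr1 (fun p : {poly R} => p`_0)).
    rewrite coefD coefMC D0 mul1r coefXM/= addr0 coef0 => c0.
    move: IH; rewrite Frec c0 mulr0 add0r => /eqP.
    by rewrite mulf_eq0 polyX_eq0 => /eqP.
  have := congr1 (fun p : {poly R} => p`_0) (Frec k).
  by rewrite Fn coefD coefMC D0 mul1r coefXM/= addr0 coef0.
have [E [sE rE]] := poly_root_seq F_neq0.
exists E; split.
  suff : (size (F 0%N) <= #|S|)%N by lia.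
  rewrite /F; apply: (leq_trans (size_sum _ _ _)).
  apply/bigmax_leqP_seq => p _ _; rewrite mul_polyC.
  exact: leq_trans (size_scale_leq _ _) (sA _).
move=> gamma U hU wU; apply: rE.
rewrite /root /F horner_sum; under eq_bigr do
  rewrite hornerM hornerC (Aval _ _ hU) mulrCA.
by rewrite -mulr_sumr wU mulr0.
Qed.

End Cramer.

(** * Variation over open intervals *)

Section OpenVariation.
Context {R : realType}.
Implicit Types (f g : R -> R) (a b x V : R) (s t : seq R).

Fixpoint pvar g x s : R :=
  if s is y :: s' then `|g y - g x| + pvar g y s' else 0.

(** The interval is open because phi may jump at the breakpoints. *)
Definition var_le g a b V : Prop := forall x s,
  path <=%R x s -> all (fun y => a < y < b) (x :: s) -> pvar g x s <= V.

Lemma pvar_cat g x s t : pvar g x (s ++ t) = pvar g x s + pvar g (last x s) t.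
Proof. by elim: s x => [|y s IH] x /=; rewrite ?add0r// IH addrA. Qed.

(** A branch of negative slope reverses the order of the points. *)
Lemma pvar_rev g x s : pvar g (last x s) (rev (belast x s)) = pvar g x s.
Proof.
elim: s x => [|y s IH] x //=.
rewrite rev_cons -cats1 pvar_cat IH /= addr0 addrC distrC; congr (`|g _ - _| + _).
by case: s {IH} => [|z s] //=; rewrite rev_cons last_rcons.
Qed.

Lemma pvar_comp g (tau : R -> R) x s :
  pvar (g \o tau) x s = pvar g (tau x) (map tau s).
Proof. by elim: s x => [|y s IH] x //=; rewrite IH. Qed.

Lemma eq_pvar f g x s : {in x :: s, f =1 g} -> pvar f x s = pvar g x s.
Proof.
elim: s x => [|y s IH] x fg //=; rewrite IH; last first.
  by move=> z zs; apply: fg; rewrite inE zs orbT.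
by rewrite !fg ?inE ?eqxx ?orbT.
Qed.

(** A partition of ]a, b[ jumps at most twice near m: onto m and off m. Each
    jump is at most 2 C. *)
Lemma var_le_glue C g a m b V1 V2 :
  (forall y, a < y < b -> `|g y| <= C) -> 0 <= C ->
  var_le g a m V1 -> var_le g m b V2 -> 0 <= V1 -> 0 <= V2 ->
  var_le g a b (V1 + V2 + 4 * C).
Proof.
move=> gC C0 var1 var2 V10 V20.
have jump y z : a < y < b -> a < z < b -> `|g y - g z| <= 2 * C.
  by move=> /gC + /gC; have := ler_normB (g y) (g z); lra.
have right x s : path <=%R x s -> all (fun y => a < y < b) (x :: s) ->
    m <= x -> pvar g x s <= V2 + 2 * C.
  elim: s x => [|y s IH] x; first by move=> _ _ _ /=; lra.
  move=> pxs axs; rewrite le_eqVlt => /predU1P[mx|mx]; last first.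
    have := var2 x (y :: s) pxs; suff -> : all (fun y => m < y < b) (x :: y :: s).
      by move=> /(_ isT); lra.
    apply/allP => z zs; have /andP[_ ->] := allP axs _ zs; rewrite andbT.
    move: zs; rewrite inE => /predU1P[->//|zs].
    by apply: (lt_le_trans mx); apply: (allP (order_path_min le_trans pxs)).
  move: pxs axs => /= /andP[xy pys] /and3P[ax ay axs].
  have [ym|ym] := eqVneq y m.
    have -> : g y - g x = 0 by rewrite ym mx subrr.
    by rewrite normr0 add0r; apply: IH => //=; rewrite ?ay// ym.
  have ym' : m < y by rewrite lt_neqAle eq_sym ym mx.
  have : pvar g y s <= V2.
    apply: var2 => //; apply/allP => z zs.
    have /allP /(_ _ zs) /andP[_ ->] : all (fun y => a < y < b) (y :: s).
      by rewrite /= ay.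
    rewrite andbT; move: zs; rewrite inE => /predU1P[->//|zs].
    by apply: (lt_le_trans ym'); apply: (allP (order_path_min le_trans pys)).
  by have := jump y x ay ax; lra.
suff left x s : path <=%R x s -> all (fun y => a < y < b) (x :: s) -> x < m ->
    pvar g x s <= V1 + V2 + 4 * C.
  move=> x s pxs axs; have [xm|xm] := ltP x m; first exact: left.
  by have := right _ _ pxs axs xm; lra.
move=> pxs axs xm.
have [s1 [s2 [sE s1m s2m]]] : exists s1 s2,
    [/\ s = s1 ++ s2, all (fun y => y < m) s1 & all (fun y => m <= y) s2].
  move/path_sorted: pxs; elim: s {axs} => [|y s IH]; first by exists [::], [::].
  move=> ys; have [ym|ym] := ltP y m; last first.
    exists [::], (y :: s); split=> //=; rewrite ym; apply/allP => z zs.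
    by apply: (le_trans ym); apply: (allP (order_path_min le_trans ys)).
  have [s1 [s2 [-> s1m s2m]]] := IH (path_sorted ys).
  by exists (y :: s1), s2; split=> //=; rewrite ym.
move: pxs axs; rewrite sE cat_path => /andP[pxs1 ps2] axs.
rewrite pvar_cat; have : pvar g x s1 <= V1.
  apply: var1 => //; apply/allP => z zs.
  have /allP/(_ z) := axs; rewrite -cat_cons mem_cat zs => /(_ isT)/andP[-> _].
  by move: zs; rewrite inE => /predU1P[->//|/(allP s1m)].
case: s2 sE s2m ps2 axs => [|y s2] sE s2m ps2 axs; first by rewrite /=; lra.
move: s2m ps2 => /= /andP[my s2m] /andP[_ ps2].
have alast : a < last x s1 < b.
  by apply: (allP axs); rewrite -cat_cons mem_cat mem_last.
have := right y s2 ps2; move: axs; rewrite -cat_cons all_cat => /andP[_ ays2].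
have /andP[ay _] := ays2.
by move=> /(_ ays2 my); have := jump y (last x s1) ay alast; lra.
Qed.

Lemma var_le_affine_pull f g (s t : R) a b l r V : s != 0 ->
  (forall x, a < x < b -> l < s * x + t < r) ->
  (forall x, a < x < b -> f x = g (s * x + t)) ->
  var_le g l r V -> var_le f a b V.
Proof.
move=> s0 lr fg varg x u pxu au.
pose tau x := s * x + t.
rewrite (@eq_pvar _ (g \o tau)); last by move=> z /(allP au)/fg.
rewrite pvar_comp.
have alr : all (fun y => l < y < r) (map tau (x :: u)).
  by apply/allP => _ /mapP[z zu ->]; apply/lr/(allP au).
have [s_gt0|s_le0] := ltP 0 s.
  apply: varg => //; rewrite path.path_map; apply: sub_path pxu => y z yz /=.
  by rewrite lerD2r ler_pM2l.
have s_lt0 : s < 0 by rewrite lt_neqAle s0.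
rewrite -pvar_rev; apply: varg.
  rewrite rev_path path.path_map; apply: sub_path pxu => y z yz /=.
  by rewrite lerD2r ler_nM2l.
by rewrite -rev_rcons -lastI all_rev.
Qed.

Lemma var_le_id_add g (gamma : R) l r V : r - l <= 1 -> 0 <= gamma ->
  var_le g l r V -> var_le (fun x => x + gamma * g x) l r (1 + gamma * V).
Proof.
move=> lr g0 varg x s pxs axs.
have le_sum : pvar (fun x => x + gamma * g x) x s
    <= (last x s - x) + gamma * pvar g x s.
  elim: s x pxs {axs} => [|y s IH] x /=; first by rewrite subrr mulr0 addr0.
  move=> /andP[xy pys]; have := IH _ pys.
  set p := pvar _ y s; set q := pvar _ y s => pq.
  rewrite mulrDr; have : `|y + gamma * g y - (x + gamma * g x)|
      <= (y - x) + gamma * `|g y - g x|.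
    rewrite opprD addrACA -mulrBr; apply: le_trans (ler_normD _ _) _.
    by rewrite normrM (ger0_norm g0) (@ger0_norm _ (y - x)) ?subr_ge0.
  by move: pq; lra.
apply: le_trans le_sum _; apply: lerD; last exact: ler_wpM2l (varg _ _ pxs axs).
have /andP[_ ] := allP axs _ (mem_last x s).
have /andP[] := allP axs x (mem_head x s).
lra.
Qed.

Lemma var_le_weaken g a b V W : V <= W -> var_le g a b V -> var_le g a b W.
Proof. by move=> VW h x s p q; apply: le_trans (h x s p q) VW. Qed.

Lemma var_le_empty g a V : var_le g a a V.
Proof.
by move=> x s _ /= /andP[/andP[/lt_trans h /h]]; rewrite ltxx.
Qed.

Lemma var_le_sum C g (c v : nat -> R) (p q : nat) : (p <= q)%N ->
  (forall y, 0 <= y <= 1 -> `|g y| <= C) -> 0 <= C ->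
  (forall k, (k <= q)%N -> 0 <= c k <= 1) ->
  (forall k, (p <= k < q)%N -> 0 <= v k /\ var_le g (c k) (c k.+1) (v k)) ->
  var_le g (c p) (c q) (\sum_(p <= k < q) (v k + 4 * C)).
Proof.
move=> + gC C0; elim: q => [|q IH].
  by rewrite leqn0 => /eqP -> _ _; exact: var_le_empty.
rewrite leq_eqVlt => /predU1P[-> _ _|]; first exact: var_le_empty.
rewrite ltnS => pq c01 vk; rewrite big_nat_recr//= addrA.
have [vq0 vq] : 0 <= v q /\ var_le g (c q) (c q.+1) (v q).
  by apply: vk; rewrite pq ltnSn.
apply: (@var_le_glue C _ _ (c q)) => //.
- move=> y ay; apply: gC.
  by have := c01 p (leqW pq); have := c01 q.+1 (leqnn _); lra.
- apply: IH => // k; first by move=> kq; apply: c01; exact: leqW.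
  by move=> /andP[pk kq]; apply: vk; rewrite pk ltnW.
rewrite big_nat_cond; apply: sumr_ge0 => k /andP[/andP[pk kq] _].
have [vk0 _] : 0 <= v k /\ var_le g (c k) (c k.+1) (v k).
  by apply: vk; rewrite pk ltnW.
by rewrite addr_ge0// mulr_ge0.
Qed.

Lemma variation_pvar g a b s : variation a b g s = pvar g a s.
Proof.
rewrite /variation; elim: s a => [|y s IH] a; first by rewrite big_nil.
rewrite big_nat_recl//= -IH; congr (_ + _).
Qed.

(** The two endpoint jumps are handled like those at an interior breakpoint, by
    extending g by zero to ]-1, 2[. *)
Lemma var_le_total_variation C g V : (forall y, 0 <= y <= 1 -> `|g y| <= C) ->
  0 <= C -> 0 <= V -> var_le g 0 1 V ->
  (total_variation 0 1 g <= (V + 8 * C)%:E)%E.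
Proof.
move=> gC C0 V0 varg.
pose h y := if 0 <= y <= 1 then g y else 0.
have hC y : `|h y| <= C by rewrite /h; case: ifP => [/gC//|_]; rewrite normr0.
have hg y : 0 <= y <= 1 -> h y = g y by rewrite /h => ->.
have varh : var_le h 0 1 V.
  move=> x s pxs axs; rewrite (@eq_pvar _ g) ?varg// => z /(allP axs).
  by move=> /andP[z0 z1]; apply: hg; rewrite !ltW.
have h0 a b : (forall y, a < y < b -> h y = 0) -> var_le h a b 0.
  move=> hab x s _ axs; rewrite (@eq_pvar _ (fun=> 0)); last first.
    by move=> z /(allP axs)/hab.
  by elim: s x {axs} => [//|y s IH] x /=; rewrite subrr normr0 add0r.
have var1 : var_le h (-1) 1 (0 + V + 4 * C).
  apply: (@var_le_glue C _ _ 0) => //; apply: h0 => y /andP[_ y0].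
  by rewrite /h leNgt y0.
have var2 : var_le h (-1) 2 (0 + V + 4 * C + 0 + 4 * C).
  apply: (@var_le_glue C _ _ 1) => //; last lra.
  by apply: h0 => y /andP[y1 _]; rewrite /h [y <= 1]leNgt y1 andbF.
rewrite /total_variation; apply: ge_ereal_sup => _ [_ [s [pas /eqP ls] <-] <-].
rewrite lee_fin variation_pvar.
have s01 y : y \in 0 :: s -> 0 <= y <= 1.
  move=> ys; apply/andP; split.
    move: ys; rewrite inE => /predU1P[->//|ys].
    by apply/ltW; apply: (allP (order_path_min lt_trans pas)).
  move: (ys); rewrite lastI ls mem_rcons inE => /predU1P[->//|].
  have : sorted <%R (0 :: s) := pas.
  rewrite lastI ls (sorted_pairwise lt_trans) -cats1 pairwise_cat /allrel => /and3P[/allP lt1 _ _] /lt1 /=.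
  by rewrite andbT => /ltW.
rewrite -(@eq_pvar h); last by move=> z /s01 /hg.
apply: le_trans (_ : 0 + V + 4 * C + 0 + 4 * C <= _); last lra.
apply: var2; first by apply: sub_path pas => y z /ltW.
by apply/allP => y /s01 /andP[y0 y1]; lra.
Qed.

End OpenVariation.

(** * Defect of affinity *)

Section AffineDefect.
Context {R : realType}.
Implicit Types (f g : R -> R) (a b m x y z v w : R).

(** The distance between g y and the value at y of the affine function which
    agrees with g at x and z. *)
Definition defect g x y z : R :=
  `|(z - y) * (g y - g x) - (y - x) * (g z - g y)| / `|z - x|.

(** The values are the sums of defects over finitely many triples of ]a, b[
    which occupy disjoint intervals. Presenting them inductively makes
    pulling back and concatenating families of triples immediate. *)
Inductive total_defect g : R -> R -> R -> Prop :=
| TotalDefect0 a b : a <= b -> total_defect g a b 0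
| TotalDefect1 a b x y z : a < x -> x < y -> y < z -> z < b ->
    total_defect g a b (defect g x y z)
| TotalDefectCat a m b v w : total_defect g a m v -> total_defect g m b w ->
    total_defect g a b (v + w).

Lemma defect_sym g x y z : defect g z y x = defect g x y z.
Proof.
by rewrite /defect distrC [`|x - z|]distrC; congr (`|_| / _); ring.
Qed.

Lemma defect_affine_comp f g (s t A B gamma : R) x y z : s != 0 ->
  0 <= gamma -> {in [:: x; y; z], forall u, f u = A * u + B + gamma * g (s * u + t)} ->
  defect f x y z = gamma * defect g (s * x + t) (s * y + t) (s * z + t).
Proof.
move=> s0 gamma0 fE; rewrite /defect !fE ?inE ?eqxx ?orbT//.
set gx := g (s * x + t); set gy := g (s * y + t); set gz := g (s * z + t).
pose N := (z - y) * (gy - gx) - (y - x) * (gz - gy).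
have -> : s * z + t - (s * x + t) = s * (z - x) by ring.
have -> : (s * z + t - (s * y + t)) * (gy - gx)
    - (s * y + t - (s * x + t)) * (gz - gy) = s * N by rewrite /N; ring.
have -> : (z - y) * (A * y + B + gamma * gy - (A * x + B + gamma * gx))
    - (y - x) * (A * z + B + gamma * gz - (A * y + B + gamma * gy)) = gamma * N.
  by rewrite /N; ring.
rewrite !normrM (ger0_norm gamma0) invfM.
by rewrite mulrACA mulfV ?normr_eq0// mul1r mulrA.
Qed.

Lemma defect_le g x y z : x < y -> y < z ->
  defect g x y z <= `|g y - g x| + `|g z - g y|.
Proof.
move=> xy yz; rewrite /defect [`|z - x|]gtr0_norm; last lra.
rewrite ler_pdivrMr; last lra.
apply: le_trans (ler_normB _ _) _; rewrite !normrM.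
rewrite (@gtr0_norm _ (z - y)) ?subr_gt0// (@gtr0_norm _ (y - x)) ?subr_gt0//.
have yx0 : 0 <= y - x by rewrite subr_ge0 ltW.
have zy0 : 0 <= z - y by rewrite subr_ge0 ltW.
have := mulr_ge0 yx0 (normr_ge0 (g y - g x)).
have := mulr_ge0 zy0 (normr_ge0 (g z - g y)).
lra.
Qed.

Lemma total_defect_le g a b w : total_defect g a b w -> a <= b.
Proof.
elim=> {a b w} [//|a b x y z ax xy yz zb|a m b v w _ am _ mb].
  by apply/ltW; do 3!(apply: lt_trans; last eassumption).
exact: le_trans mb.
Qed.

Lemma total_defect_le_variation g a b w : total_defect g a b w ->
  (w%:E <= total_variation a b g)%E.
Proof.
elim=> {a b w} [a b ab|a b x y z ax xy yz zb|a m b v w am IHam mb IHmb].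
- exact: total_variation_ge0.
- have le1 := le_trans (ltW xy) (ltW yz); have le2 := le_trans le1 (ltW zb).
  rewrite (total_variationD g (ltW ax))//.
  rewrite (total_variationD g le1 (ltW zb)).
  rewrite (total_variationD g (ltW xy) (ltW yz)).
  apply: (@le_trans _ _ (total_variation x y g + total_variation y z g)%E).
    apply: (@le_trans _ _ (`|g y - g x| + `|g z - g y|)%:E).
      by rewrite lee_fin defect_le.
    by rewrite EFinD leeD// total_variation_ge// ltW.
  rewrite addeCA leeDl// adde_ge0// total_variation_ge0// ltW//.
rewrite EFinD (total_variationD g (total_defect_le am) (total_defect_le mb)).
exact: leeD.
Qed.

(** The triples are transported by the inverse of x |-> s x + t. If s < 0 the
    order of the triples, and of the points of each, is reversed. *)
Lemma total_defect_affine_pull f g (s t A B gamma : R) l r w : s != 0 ->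
  0 <= gamma -> total_defect g l r w -> forall a b,
  (if 0 < s then (s * a + t = l) /\ (s * b + t = r)
   else (s * a + t = r) /\ (s * b + t = l)) ->
  (forall x, a < x < b -> f x = A * x + B + gamma * g (s * x + t)) ->
  total_defect f a b (gamma * w).
Proof.
move=> s0 gamma0; have sK u : s * ((u - t) / s) + t = u.
  by rewrite mulrC divfK// subrK.
have [s_gt0|s_le0] := ltP 0 s; last first.
  have s_lt0 : s < 0 by rewrite lt_neqAle s0.
  have mono u v : s * u + t < s * v + t -> v < u by rewrite ltrD2r ltr_nM2l.
  have monoW u v : s * u + t <= s * v + t -> v <= u by rewrite lerD2r ler_nM2l.
  elim=> {l r w} [l r lr|l r x y z lx xy yz zr|l m r v w dv IHv dw IHw] a b [aE bE] fE.
  - by rewrite mulr0; apply: TotalDefect0; apply: monoW; rewrite aE bE.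
  - rewrite -[x]sK -[y]sK -[z]sK defect_sym -(@defect_affine_comp f _ _ _ A B)//.
      by apply: TotalDefect1; apply: mono; rewrite ?aE ?bE ?sK.
    move=> u; rewrite !inE => /or3P[] /eqP ->; apply: fE; apply/andP; split;
      apply: mono; rewrite ?aE ?bE ?sK//; lra.
  - rewrite mulrDr addrC; have lm := total_defect_le dv.
    have mr := total_defect_le dw.
    apply: (@TotalDefectCat _ _ ((m - t) / s)).
      apply: IHw; rewrite ?sK//= => x /andP[ax xm]; apply: fE; rewrite ax.
      by apply: lt_le_trans xm _; apply: monoW; rewrite sK bE.
    apply: IHv; rewrite ?sK//= => x /andP[mx xb]; apply: fE; rewrite xb andbT.
    by apply: le_lt_trans mx; apply: monoW; rewrite sK aE.
have mono u v : s * u + t < s * v + t -> u < v by rewrite ltrD2r ltr_pM2l.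
have monoW u v : s * u + t <= s * v + t -> u <= v by rewrite lerD2r ler_pM2l.
elim=> {l r w} [l r lr|l r x y z lx xy yz zr|l m r v w dv IHv dw IHw] a b [aE bE] fE.
- by rewrite mulr0; apply: TotalDefect0; apply: monoW; rewrite aE bE.
- rewrite -[x]sK -[y]sK -[z]sK -(@defect_affine_comp f _ _ _ A B)//.
    by apply: TotalDefect1; apply: mono; rewrite ?aE ?bE ?sK.
  move=> u; rewrite !inE => /or3P[] /eqP ->; apply: fE; apply/andP; split;
    apply: mono; rewrite ?aE ?bE ?sK//; lra.
- rewrite mulrDr; have lm := total_defect_le dv.
  have mr := total_defect_le dw.
  apply: (@TotalDefectCat _ _ ((m - t) / s)).
    apply: IHv; rewrite ?sK//= => x /andP[ax xm]; apply: fE; rewrite ax.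
    by apply: lt_le_trans xm _; apply: monoW; rewrite sK bE.
  apply: IHw; rewrite ?sK//= => x /andP[mx xb]; apply: fE; rewrite xb andbT.
  by apply: le_lt_trans mx; apply: monoW; rewrite sK aE.
Qed.

Lemma total_defect_sum g (c w : nat -> R) (p q : nat) : (p <= q)%N ->
  (forall k, (p <= k < q)%N -> total_defect g (c k) (c k.+1) (w k)) ->
  total_defect g (c p) (c q) (\sum_(p <= k < q) w k).
Proof.
elim: q => [|q IH]; first by rewrite leqn0 => /eqP -> _; rewrite big_geq//; exact: TotalDefect0.
rewrite leq_eqVlt => /predU1P[-> _|].
  by rewrite big_geq//; exact: TotalDefect0.
rewrite ltnS => pq dk; rewrite big_nat_recr//=.
apply: (@TotalDefectCat _ _ (c q)); last by apply: dk; rewrite pq leqnn.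
by apply: IH => // k /andP[pk kq]; apply: dk; rewrite pk ltnW.
Qed.

Lemma defect0_affine g a b : a < b ->
  (forall x y z, a < x -> x < y -> y < z -> z < b -> defect g x y z = 0) ->
  exists A B, forall x, a < x < b -> g x = A * x + B.
Proof.
move=> ab d0.
have dE x y z : a < x -> x < y -> y < z -> z < b ->
    (z - y) * (g y - g x) = (y - x) * (g z - g y).
  move=> ax xy yz zb; have /eqP := d0 _ _ _ ax xy yz zb.
  rewrite mulf_eq0 invr_eq0 !normr_eq0 => /orP[/eqP|/eqP]; last lra.
  by move/eqP; rewrite subr_eq0 => /eqP.
pose u := a + (b - a) / 3; pose v := a + 2 * (b - a) / 3.
have au : a < u by rewrite /u; lra.
have uv : u < v by rewrite /u /v; lra.
have vb : v < b by rewrite /v; lra.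
pose A := (g v - g u) / (v - u).
exists A, (g u - A * u) => x /andP[ax xb].
have vu0 : v - u != 0 by rewrite subr_eq0 gt_eqF.
suff key : (g x - g u) * (v - u) = (g v - g u) * (x - u).
  rewrite addrCA -mulrBr /A mulrAC -key mulfK//; ring.
have [xu|ux|->] := ltgtP x u; last by ring.
  have := dE x u v ax xu uv vb; lra.
have [xv|vx|->] := ltgtP x v; last by ring.
  have := dE u x v au ux xv vb; lra.
have := dE u v x au uv vx xb; lra.
Qed.

End AffineDefect.

(** * Branches of a Markov map *)

Section MarkovStructure.
Context {R : realType} {N : nat} (c : nat -> R) (s : 'I_N -> R) (T : R -> R).
Hypothesis hT : affine_markov_map c s T.

Lemma breakpoint_lt (i j : nat) : (i < j)%N -> (j <= N)%N -> c i < c j.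
Proof.
elim: j => // j IH; rewrite ltnS leq_eqVlt => /predU1P[->|ij] jN.
  exact: (amm_incr hT (Ordinal jN)).
exact: lt_trans (IH ij (ltnW jN)) (amm_incr hT (Ordinal jN)).
Qed.

Lemma breakpoint_le (i j : nat) : (i <= j)%N -> (j <= N)%N -> c i <= c j.
Proof.
by rewrite leq_eqVlt => /predU1P[->//|ij] jN; apply/ltW/breakpoint_lt.
Qed.

Lemma breakpoint_lt_inv (i j : nat) : (i <= N)%N -> c i < c j -> (i < j)%N.
Proof. by move=> iN; rewrite ltnNge ltNge; apply: contraNN => ji; apply: breakpoint_le. Qed.

Lemma atomE (i : 'I_N) x : atom c i x = (c i < x < c i.+1) :> Prop.
Proof. by rewrite /atom/= in_itv. Qed.

Lemma breakpoint01 k : (k <= N)%N -> 0 <= c k <= 1.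
Proof.
by move=> kN; rewrite -(amm_first hT) -(amm_last hT) !breakpoint_le.
Qed.

Lemma atom01 (i : 'I_N) x : atom c i x -> 0 <= x <= 1.
Proof.
rewrite atomE => /andP[ix xi].
have /andP[c0 _] := breakpoint01 (ltnW (ltn_ord i)).
have /andP[_ c1] := breakpoint01 (ltn_ord i).
lra.
Qed.

Lemma map01 x : 0 <= x <= 1 -> 0 <= T x <= 1.
Proof.
by move=> x01; have := amm_maps hT (x := x); rewrite /= !in_itv; apply.
Qed.

Lemma breakpoint_or_atom y : 0 <= y <= 1 ->
  (exists2 k, (k <= N)%N & y = c k) \/ exists j : 'I_N, atom c j y.
Proof.
rewrite -(amm_first hT) -(amm_last hT) => /andP[cy].
suff : forall n, (n <= N)%N -> y <= c n ->
    (exists2 k, (k <= N)%N & y = c k) \/ exists j : 'I_N, atom c j y.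
  by apply.
elim=> [|n IH] nN yc.
  by left; exists 0%N => //; apply/eqP; rewrite eq_le yc cy.
have [ycn|cny] := leP y (c n); first exact: IH (ltnW nN) ycn.
move: yc; rewrite le_eqVlt => /predU1P[->|yc]; first by left; exists n.+1.
by right; exists (Ordinal nN); rewrite atomE cny.
Qed.

(** The combinatorial content of the Markov property: the image of the i-th
    atom is the interval ]c (p i), c (q i)[, so that the i-th row of the
    transition matrix is the indicator of an integer interval. *)
Record branches (b : 'I_N -> R) (p q : 'I_N -> nat) : Prop := Branches {
  branch_affine : forall (i : 'I_N) x, c i < x < c i.+1 -> T x = s i * x + b i ;
  branch_lt : forall i, (p i < q i)%N ;
  branch_leN : forall i, (q i <= N)%N ;
  branch_ends : forall i : 'I_N,
    if 0 < s i then (s i * c i + b i = c (p i)) /\ (s i * c i.+1 + b i = c (q i))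
    else (s i * c i + b i = c (q i)) /\ (s i * c i.+1 + b i = c (p i)) ;
  branch_mx : forall i j : 'I_N,
    transition_matrix N c T i j = ((p i <= j < q i)%N)%:R }.

(** The image of an atom is an open interval ]l, r[. If l were in an atom, then
    this atom would meet the image without being contained in it; so l is a
    breakpoint, and likewise r. *)
Lemma affine_branchP (i : 'I_N) : exists (b : R) (p q : nat),
  [/\ forall x, c i < x < c i.+1 -> T x = s i * x + b,
      (p < q)%N /\ (q <= N)%N,
      if 0 < s i then (s i * c i + b = c p) /\ (s i * c i.+1 + b = c q)
      else (s i * c i + b = c q) /\ (s i * c i.+1 + b = c p) &
      forall j : 'I_N, transition_matrix N c T i j = ((p <= j < q)%N)%:R].
Proof.
have [b Tb] := amm_affine hT i.
have cc := amm_incr hT i; have s0 := amm_slope hT i.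
have sneg : s i <= 0 -> s i < 0 by rewrite [_ < 0]lt_neqAle s0.
pose u := s i * c i + b; pose v := s i * c i.+1 + b.
pose l := if 0 < s i then u else v; pose r := if 0 < s i then v else u.
have imE y : (T @` atom c i) y <-> l < y < r.
  split=> [[x ix <-]|lyr].
    rewrite (Tb _ ix); move: ix; rewrite atomE /l /r /u /v => /andP[ix xi].
    have [sp|sn] := ltP 0 (s i); rewrite !ltrD2r.
      by rewrite !ltr_pM2l// ?ix ?xi.
    by rewrite !ltr_nM2l ?sneg// ?ix ?xi.
  have yK : s i * ((y - b) / s i) + b = y by rewrite mulrC divfK// subrK.
  have ix : atom c i ((y - b) / s i).
    move: lyr; rewrite atomE -{1 2}yK /l /r /u /v.
    have [sp|sn] := ltP 0 (s i); rewrite !ltrD2r.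
      by rewrite !ltr_pM2l.
    by rewrite !ltr_nM2l ?sneg// andbC.
  by exists ((y - b) / s i); rewrite ?Tb.
have lr : l < r.
  rewrite /l /r /u /v; have [sp|sn] := ltP 0 (s i); rewrite !ltrD2r.
    by rewrite ltr_pM2l.
  by rewrite ltr_nM2l ?sneg.
have im01 y : l < y < r -> 0 <= y <= 1.
  by move=> /imE[x /atom01 x01 <-]; apply: map01.
have l01 : 0 <= l <= 1.
  have m01 := im01 ((l + r) / 2); rewrite leNgt; apply/andP; split; last lra.
  apply/negP => l0; have [r0|r0] := leP r 0; first lra.
  by have := im01 (l / 2); lra.
have r01 : 0 <= r <= 1.
  have m01 := im01 ((l + r) / 2); rewrite [r <= 1]leNgt; apply/andP; split; first lra.
  apply/negP => r1; have [l1|l1] := leP 1 l; first lra.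
  by have := im01 ((1 + r) / 2); lra.
have full (j : 'I_N) y : l < y < r -> atom c j y -> forall z, atom c j z -> l < z < r.
  move=> lyr jy z jz; apply/imE; apply: (amm_markov hT) jz.
  by exists y; split=> //; apply/imE.
have [p pN lE] : exists2 k, (k <= N)%N & l = c k.
  have [//|[j jl]] := breakpoint_or_atom l01.
  have := full j; move: jl; rewrite atomE => /andP[jl lj] fullj.
  pose y := (l + Num.min r (c j.+1)) / 2.
  have /andP[m1 m2] : l < Num.min r (c j.+1) <= r.
    by rewrite lt_min lr lj ge_min lexx.
  have m3 : Num.min r (c j.+1) <= c j.+1 by rewrite ge_min lexx orbT.
  have := fullj y; rewrite atomE /y => /(_ _ _ ((c j + l) / 2)).
  rewrite atomE; lra.
have [q qN rE] : exists2 k, (k <= N)%N & r = c k.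
  have [//|[j jl]] := breakpoint_or_atom r01.
  have := full j; move: jl; rewrite atomE => /andP[jr rj] fullj.
  pose y := (r + Num.max l (c j)) / 2.
  have /andP[m1 m2] : l <= Num.max l (c j) < r.
    by rewrite gt_max lr jr le_max lexx.
  have m3 : c j <= Num.max l (c j) by rewrite le_max lexx orbT.
  have := fullj y; rewrite atomE /y => /(_ _ _ ((c j.+1 + r) / 2)).
  rewrite atomE; lra.
exists b, p, q; split.
- by move=> x ix; apply: Tb; rewrite atomE.
- by split=> //; apply: breakpoint_lt_inv => //; rewrite -lE -rE.
- by move: lE rE; rewrite /l /r /u /v; case: ifP.
move=> j; rewrite mxE; congr (nat_of_bool _)%:R.
have cj := amm_incr hT j.
apply/asboolP/andP => [jsub|[pj jq] y].
  have := jsub ((c j + c j.+1) / 2); rewrite atomE => /(_ _)/imE.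
  rewrite lE rE => /(_ _)/andP[|lj jr]; first lra.
  split; first by rewrite -ltnS; apply: breakpoint_lt_inv => //; lra.
  by apply: breakpoint_lt_inv; [exact: ltnW|lra].
rewrite atomE => /andP[jy yj]; apply/imE; rewrite lE rE.
have := breakpoint_le pj (ltnW (ltn_ord j)); have := breakpoint_le jq qN; lra.
Qed.

Lemma branches_exist : exists b p q, branches b p q.
Proof.
have [b hb] := choice affine_branchP.
have [p hp] := choice hb; have [q hq] := choice hp.
by exists b, p, q; split=> i; have [? [? ?] ? ?] := hq i.
Qed.

End MarkovStructure.

(** * Counting words *)

Lemma card_cons_tuple (S : finType) k (P : pred (seq S)) :
  #|[pred t : k.+1.-tuple S | P t]|
  = (\sum_i #|[pred t : k.-tuple S | P (i :: t)]|)%N.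
Proof.
rewrite -sum1_card; under [RHS]eq_bigr do rewrite -sum1_card.
rewrite pair_big_dep/= (reindex (fun u : S * k.-tuple S => cons_tuple u.1 u.2)) //.
exists (fun t : k.+1.-tuple S => (thead t, behead_tuple t)) => [[i t]|t] _ /=.
  by congr (_, _); apply: val_inj.
by rewrite [RHS]tuple_eta; apply: val_inj.
Qed.

Section Words.
Context {R : realType} {N : nat} (c : nat -> R) (s : 'I_N -> R) (T : R -> R).
Context (b : 'I_N -> R) (p q : 'I_N -> nat).
Hypothesis hT : affine_markov_map c s T.
Hypothesis hB : branches c s T b p q.
Local Notation M := (transition_matrix N c T).

Definition edge (i j : 'I_N) := (p i <= j < q i)%N.

Lemma mx_edge i j : M i j = (edge i j)%:R.
Proof. exact: branch_mx hB i j. Qed.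

Lemma edgeP i j : edge i j <-> atom c j `<=` T @` atom c i.
Proof.
have := mx_edge i j; rewrite mxE; case: asboolP => h; case: edge => // /eqP.
  by rewrite oner_eq0.
by rewrite eq_sym oner_eq0.
Qed.

Fixpoint visits (w : seq 'I_N) (x : R) : Prop :=
  if w is i :: w' then atom c i x /\ visits w' (T x) else True.

Lemma cylinderE k (w : k.-tuple 'I_N) x : cylinder c T w x <-> visits w x.
Proof.
elim: k w x => [|k IH] w x; first by rewrite tuple0; split=> // _ [].
case/tupleP: w => i w /=; split=> [h|[ix wx]].
  split; first exact: (h ord0).
  by apply/IH => l; have := h (lift ord0 l); rewrite tnthS lift0 iterSr.
move=> l; case: (unliftP ord0 l) => [l' ->|-> //].
by rewrite tnthS lift0 iterSr; apply: (proj2 (IH w (T x)) wx).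
Qed.

(** If T maps I_i onto I_j, then a point which follows the word from I_j on has
    a preimage in I_i. Hence a cylinder is nonempty as soon as the successive
    transitions of its word are allowed. *)
Lemma visits_edge w : (exists x, visits w x) <-> sorted edge w.
Proof.
case: w => [|i w]; first by split=> // _; exists 0.
elim: w i => [|j w IH] i /=.
  split=> // _; exists ((c i + c i.+1) / 2); split=> //.
  by rewrite atomE; have := amm_incr hT i; lra.
split=> [[x [ix [jx wx]]]|/andP[/edgeP ij jw]].
  apply/andP; split; last by apply/IH; exists (T x).
  apply/edgeP/(amm_markov hT); exists (T x); split=> //; by exists x.
have [y [jy wy]] := (proj2 (IH j)) jw.
by have [x ix xy] := ij y jy; exists x; rewrite xy.
Qed.

Lemma num_branches0 : num_branches N c T 0 = 1%N.
Proof.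
rewrite /num_branches (_ : [set _ | _]%SET = [set [tuple]]%SET) ?cards1//.
apply/setP => w; rewrite !inE tuple0 eqxx; apply/asboolP.
by exists 0 => -[].
Qed.

Lemma card_paths k i : (#|[pred t : k.-tuple 'I_N | path edge i t]|)%:R
  = \sum_j (M ^+ k) i j.
Proof.
elim: k i => [|k IH] i.
  rewrite expr0 (bigD1 i)//= big1 => [|j ji]; last first.
    by rewrite mxE eq_sym (negbTE ji).
  rewrite mxE eqxx addr0 (_ : #|_| = 1%N)//.
  by rewrite -(expn0 #|'I_N|) -card_tuple; apply: eq_card => t; rewrite inE tuple0.
rewrite (card_cons_tuple k (path edge i)) natr_sum.
under [RHS]eq_bigr do rewrite exprS -mulmxE mxE.
rewrite exchange_big/=; apply: eq_bigr => l _.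
rewrite -mulr_sumr mx_edge; case: edge; rewrite ?mul1r ?mul0r -?IH//.
by rewrite eq_card0.
Qed.

Lemma num_branchesS k : (num_branches N c T k.+1)%:R
  = \sum_i \sum_j (M ^+ k) i j.
Proof.
rewrite /num_branches cardsE.
rewrite (eq_card (_ : _ =i [pred w : k.+1.-tuple 'I_N | sorted edge w])); last first.
  move=> w; rewrite !inE; apply/asboolP/idP => [[x /cylinderE wx]|].
    by apply/visits_edge; exists x.
  by move=> /visits_edge[x wx]; exists x; apply/cylinderE.
rewrite (card_cons_tuple k (sorted edge)) natr_sum.
by apply: eq_bigr => i _; exact: card_paths.
Qed.

Lemma mx_pow_ge0 k i j : 0 <= (M ^+ k) i j.
Proof.
elim: k i j => [|k IH] i j; first by rewrite expr0 mxE ler0n.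
rewrite exprS -mulmxE mxE; apply: sumr_ge0 => l _.
by rewrite mulr_ge0// mx_edge ler0n.
Qed.

Lemma mx_pow_nat k i j : (M ^+ k) i j \is a Num.nat.
Proof.
elim: k i j => [|k IH] i j; first by rewrite expr0 mxE natr_nat.
by rewrite exprS -mulmxE mxE rpred_sum// => l _; rewrite rpredM// mx_edge natr_nat.
Qed.

Lemma edge_start i : exists j, edge i j.
Proof.
have pN : (p i < N)%N := leq_trans (branch_lt hB i) (branch_leN hB i).
by exists (Ordinal pN); rewrite /edge /= leqnn (branch_lt hB).
Qed.

Lemma row_sum_ge1 k i : 1 <= \sum_j (M ^+ k) i j.
Proof.
elim: k i => [|k IH] i.
  by rewrite expr0 (bigD1 i)//= mxE eqxx lerDl; apply: sumr_ge0 => j _; rewrite mxE ler0n.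
have [l il] := edge_start i.
under eq_bigr do rewrite exprS -mulmxE mxE.
rewrite exchange_big/= (bigD1 l)//= -mulr_sumr mx_edge il mul1r.
apply: le_trans (IH l) _; rewrite lerDl; apply: sumr_ge0 => m _.
by apply: sumr_ge0 => j _; rewrite mulr_ge0 ?mx_pow_ge0// mx_edge ler0n.
Qed.

Lemma num_atoms_gt0 : (0 < N)%N.
Proof.
rewrite lt0n; apply/eqP => N0.
by have := amm_last hT; rewrite N0 (amm_first hT) => /eqP; rewrite eq_sym oner_eq0.
Qed.

Lemma num_branches_ge1 k : 1 <= (num_branches N c T k)%:R :> R.
Proof.
case: k => [|k]; first by rewrite num_branches0.
rewrite num_branchesS (bigD1 (Ordinal num_atoms_gt0))//=.
apply: le_trans (row_sum_ge1 k (Ordinal num_atoms_gt0)) _; rewrite lerDl; apply: sumr_ge0 => i _.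
by apply: sumr_ge0 => j _; exact: mx_pow_ge0.
Qed.

(** Cut the words of length k + l after k letters, which amounts to bounding
    by 1 the entry of the matrix which links the two parts. *)
Lemma num_branches_submult k l : (num_branches N c T (k + l))%:R
  <= (num_branches N c T k)%:R * (num_branches N c T l)%:R :> R.
Proof.
case: k => [|k]; first by rewrite num_branches0 mul1r.
case: l => [|l]; first by rewrite num_branches0 mulr1 addn0.
rewrite addSn !num_branchesS big_distrl/=; apply: ler_sum => i _.
rewrite big_distrl/= addnS -addSn.
under eq_bigr do rewrite exprD -mulmxE mxE.
rewrite exchange_big/=.
under eq_bigr do rewrite -mulr_sumr exprSr -mulmxE mxE big_distrl/=.
rewrite exchange_big/=; apply: ler_sum => j _.
rewrite mulr_sumr; apply: ler_sum => m _.
rewrite -mulrA ler_wpM2l ?mx_pow_ge0// mulr_sumr; apply: ler_sum => n _.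
by rewrite ler_piMl ?mx_pow_ge0// mx_edge lern1 leq_b1.
Qed.

End Words.

(** * Finite variation *)

Section Phi.
Context {R : realType} {N : nat} (c : nat -> R) (s : 'I_N -> R) (T : R -> R).
Context (b : 'I_N -> R) (p q : 'I_N -> nat).
Hypothesis hT : affine_markov_map c s T.
Hypothesis hB : branches c s T b p q.
Context (gamma : R).
Hypothesis gamma_gt0 : 0 < gamma.
Hypothesis gamma_lt1 : gamma < 1.
Local Notation M := (transition_matrix N c T).
Local Notation phi := (phi T gamma).

Let gamma_ge0 : 0 <= gamma. Proof. exact: ltW. Qed.

Definition phi_sum K x := series (fun k => gamma ^+ k * iter k.+1 T x) K.

Lemma phi_sum0 x : phi_sum 0 x = 0.
Proof. by rewrite /phi_sum /series/= big_geq. Qed.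

Lemma phi_sumS K x : phi_sum K.+1 x = T x + gamma * phi_sum K (T x).
Proof.
rewrite /phi_sum /series/= big_nat_recl//= expr0 mul1r; congr (_ + _).
by rewrite mulr_sumr; apply: eq_bigr => k _; rewrite exprS mulrA -iterSr.
Qed.

Let C := (1 - gamma)^-1.

Let C_ge0 : 0 <= C. Proof. by rewrite invr_ge0 subr_ge0 ltW. Qed.

Lemma phi_sum_bound K x : 0 <= x <= 1 -> `|phi_sum K x| <= C.
Proof.
elim: K x => [|K IH] x x01; first by rewrite phi_sum0 normr0.
rewrite phi_sumS (_ : C = 1 + gamma * C); last first.
  by rewrite /C; field; rewrite subr_eq0 gt_eqF.
have /andP[T0 T1] := map01 hT x01; apply: le_trans (ler_normD _ _) _.
rewrite normrM (ger0_norm gamma_ge0) (ger0_norm T0) lerD// ler_wpM2l//.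
by apply: IH; rewrite T0.
Qed.

Lemma iter01 k x : 0 <= x <= 1 -> 0 <= iter k T x <= 1.
Proof. by move=> x01; elim: k => //= k; exact: (map01 hT). Qed.

Lemma phi_sum_cvg x : 0 <= x <= 1 -> (fun K => phi_sum K x) @ \oo --> phi x.
Proof.
move=> x01; apply: nondecreasing_is_cvgn.
  apply/nondecreasing_seqP => K; rewrite /phi_sum seriesSr lerDl mulr_ge0//.
    exact: exprn_ge0.
  by have /andP[] := iter01 K.+1 x01.
exists C => _ [K _ <-]; apply: le_trans (ler_norm _) _; exact: phi_sum_bound.
Qed.

Lemma phi_fun_eq x : 0 <= x <= 1 -> phi x = T x + gamma * phi (T x).
Proof.
move=> x01; have cvg1 : (fun K => phi_sum K.+1 x) @ \oo --> phi x.
  by have := phi_sum_cvg x01; rewrite -(cvg_shiftS (fun K => phi_sum K x)).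
apply: (cvg_unique _ cvg1) => //=.
under eq_fun do rewrite phi_sumS.
apply: cvgD; first exact: cvg_cst.
by apply: cvgM; [exact: cvg_cst|apply: phi_sum_cvg; exact: (map01 hT)].
Qed.

Lemma phi_bound x : 0 <= x <= 1 -> `|phi x| <= C.
Proof.
move=> x01.
have h : (fun K => `|phi_sum K x|) @ \oo --> `|phi x|.
  exact: cvg_norm (phi_sum_cvg x01).
rewrite -(cvg_lim _ h)//; apply: limr_le; first by apply/cvg_ex; exists `|phi x|.
by near=> K; exact: phi_sum_bound.
Unshelve. all: by end_near. Qed.

(** Functions of the atoms as sequences, so that the atoms of an image can be
    summed over an interval of integers. *)
Definition ext (v : 'I_N -> R) (k : nat) : R := oapp v 0 (insub k).

Lemma sum_edge i (v : 'I_N -> R) :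
  \sum_(p i <= k < q i) ext v k = \sum_j M i j * v j.
Proof.
rewrite (big_nat_widen _ _ N) ?(branch_leN hB)// (big_nat_widenl _ 0)//.
rewrite big_mkord big_mkcond/=; apply: eq_bigr => j _.
rewrite (mx_edge hB) /ext valK /edge /= andbC.
by case: (_ && _); rewrite ?mul1r ?mul0r.
Qed.

Lemma sum_atoms (v : 'I_N -> R) : \sum_(0 <= k < N) ext v k = \sum_j v j.
Proof. by rewrite big_mkord; apply: eq_bigr => j _; rewrite /ext valK. Qed.

Definition growth K i := \sum_(l < K.+1) gamma ^+ l * \sum_j (M ^+ l) i j.

Lemma growth_ge1 K i : 1 <= growth K i.
Proof.
rewrite /growth big_ord_recl expr0 mul1r.
apply: le_trans (row_sum_ge1 hB 0 i) _; rewrite lerDl.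
apply: sumr_ge0 => l _; rewrite mulr_ge0 ?exprn_ge0//.
by apply: sumr_ge0 => j _; apply: (mx_pow_ge0 hB).
Qed.

Lemma growthS K i : growth K.+1 i = 1 + gamma * \sum_j M i j * growth K j.
Proof.
rewrite /growth big_ord_recl expr0 mul1r; congr (_ + _).
  by rewrite (bigD1 i)//= mxE eqxx big1 ?addr0// => j ji; rewrite mxE eq_sym (negbTE ji).
under [in RHS]eq_bigr do rewrite mulr_sumr.
rewrite exchange_big/= mulr_sumr; apply: eq_bigr => l _.
rewrite /bump /= add1n exprS -mulrA; congr (_ * _).
under [in RHS]eq_bigr do rewrite mulrCA.
rewrite -mulr_sumr; congr (_ * _).
under eq_bigr do rewrite exprS -mulmxE mxE.
by rewrite exchange_big/=; apply: eq_bigr => j _; rewrite mulr_sumr.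
Qed.

Let bnd K i := (1 + 4 * C) * growth K i - 4 * C.

Let bnd_ge0 K i : 0 <= bnd K i.
Proof.
have := ler_wpM2l (_ : 0 <= 1 + 4 * C) (growth_ge1 K i).
by rewrite /bnd; move: C_ge0; lra.
Qed.

(** The bound grows by the recursion v_(K+1) = 1 + gamma M (v_K + 4 C), the
    cost of a breakpoint being 4 C; in terms of v_K + 4 C it reads
    w_(K+1) = (1 + 4 C) + gamma M w_K, which is [growthS] up to the factor. *)
Lemma var_le_phi_sum K (i : 'I_N) : var_le (phi_sum K) (c i) (c i.+1) (bnd K i).
Proof.
elim: K i => [|K IH] i.
  move=> x u _ _; rewrite (@eq_pvar _ _ (fun=> 0)); last first.
    by move=> z _; rewrite phi_sum0.
  apply: le_trans (bnd_ge0 0 i).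
  by elim: u x => [//|y u IH] x /=; rewrite subrr normr0 add0r.
have img : var_le (phi_sum K) (c (p i)) (c (q i))
    (\sum_(p i <= k < q i) (ext (bnd K) k + 4 * C)).
  apply: var_le_sum => //.
  - exact: ltnW (branch_lt hB i).
  - exact: phi_sum_bound.
  - move=> k kq; apply: (breakpoint01 hT); exact: leq_trans kq (branch_leN hB i).
  move=> k /andP[pk kq]; have kN := leq_trans kq (branch_leN hB i).
  rewrite /ext (insubT (fun k => k < N)%N kN)/=.
  by split; [exact: bnd_ge0|exact: (IH (Ordinal kN))].
have pq : c (q i) - c (p i) <= 1.
  have := breakpoint01 hT (branch_leN hB i).
  have := breakpoint01 hT (ltnW (leq_trans (branch_lt hB i) (branch_leN hB i))).
  lra.
have -> : bnd K.+1 i = 1 + gamma * \sum_(p i <= k < q i) (ext (bnd K) k + 4 * C).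
  rewrite (eq_big_nat _ _ (F2 := ext (fun j => (1 + 4 * C) * growth K j))); last first.
    move=> k /andP[pk kq]; have kN := leq_trans kq (branch_leN hB i).
    by rewrite /ext (insubT (fun k => k < N)%N kN)/= /bnd subrK.
  rewrite sum_edge /bnd growthS.
  under [in RHS]eq_bigr do rewrite /= mulrCA.
  rewrite -mulr_sumr; ring.
apply: (var_le_affine_pull (t := b i) (amm_slope hT i) _ _
  (var_le_id_add pq gamma_ge0 img)).
  move=> x /andP[ix xi]; have := branch_ends hB i.
  have [sp|sn] := ltP 0 (s i); case=> <- <-; rewrite !ltrD2r.
    by rewrite !ltr_pM2l// ix xi.
  have sneg : s i < 0 by rewrite lt_neqAle sn (amm_slope hT i).
  by rewrite !ltr_nM2l// ix xi.
by move=> x ix; rewrite phi_sumS (branch_affine hB ix).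
Qed.

Lemma sum_growth K :
  \sum_i growth K i = \sum_(l < K.+1) gamma ^+ l * (num_branches N c T l.+1)%:R.
Proof.
rewrite /growth exchange_big/=; apply: eq_bigr => l _.
by rewrite -mulr_sumr (num_branchesS hT hB).
Qed.

(** The bound for the partial sums is uniform, so it passes to the limit for
    each fixed partition. *)
Lemma phi_bounded_variation B :
  (forall n, \sum_(l < n) gamma ^+ l * (num_branches N c T l.+1)%:R <= B) ->
  (total_variation 0 1 phi < +oo)%E.
Proof.
move=> hB'; have B0 : 0 <= B by have := hB' 0%N; rewrite big_ord0.
have C41 : 0 <= 1 + 4 * C by move: C_ge0; lra.
apply: (@le_lt_trans _ _ ((1 + 4 * C) * B + 8 * C)%:E); last exact: ltry.
apply: var_le_total_variation => //; [exact: phi_bound|exact: mulr_ge0|].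
have sum_le K : var_le (phi_sum K) 0 1 ((1 + 4 * C) * B).
  apply: (@var_le_weaken _ _ _ _ (\sum_(0 <= k < N) (ext (bnd K) k + 4 * C))).
    rewrite (eq_big_nat _ _ (F2 := ext (fun j => (1 + 4 * C) * growth K j))); last first.
      move=> k /andP[_ kN].
      by rewrite /ext (insubT (fun k => k < N)%N kN)/= /bnd subrK.
    by rewrite sum_atoms -mulr_sumr sum_growth ler_wpM2l.
  rewrite -[X in var_le _ X](amm_first hT) -[X in var_le _ _ X](amm_last hT).
  apply: var_le_sum => //.
  - exact: phi_sum_bound.
  - move=> k; exact: (breakpoint01 hT).
  move=> k /andP[_ kN]; rewrite /ext (insubT (fun k => k < N)%N kN)/=.
  by split; [exact: bnd_ge0|exact: (@var_le_phi_sum K (Ordinal kN))].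
move=> x u pxu au.
have lim_pvar : (fun K => pvar (phi_sum K) x u) @ \oo --> pvar phi x u.
  have in01 z : z \in x :: u -> 0 <= z <= 1 by move=> /(allP au) /andP[z0 z1]; rewrite !ltW.
  elim: u x {pxu au} in01 => [|y u IH] x in01 /=; first exact: cvg_cst.
  apply: cvgD; last by apply: IH => z zu; apply: in01; rewrite inE zu orbT.
  by apply: cvg_norm; apply: cvgB; apply: phi_sum_cvg; apply: in01;
    rewrite !inE eqxx ?orbT.
rewrite -(cvg_lim _ lim_pvar)//; apply: limr_le.
  by apply/cvg_ex; exists (pvar phi x u).
by near=> K; apply: sum_le.
Unshelve. all: by end_near. Qed.

End Phi.

(** * Infinite variation *)

Lemma affine_coef_unique (F : fieldType) (A B A' B' x y : F) : x != y ->
  A * x + B = A' * x + B' -> A * y + B = A' * y + B' -> A = A' /\ B = B'.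
Proof.
move=> xy ex ey; have AA : A = A'.
  apply/eqP; rewrite -subr_eq0; have : (A - A') * (x - y) == 0.
    by apply/eqP; rewrite mulrBl !mulrBr; move: ex ey => /(canRL (addrK _)) -> /(canRL (addrK _)) ->; ring.
  by rewrite mulf_eq0 [x - y == 0]subr_eq0 (negbTE xy) orbF.
by split=> //; move: ex; rewrite AA => /addrI.
Qed.

Section Lower.
Context {R : realType} {N : nat} (c : nat -> R) (s : 'I_N -> R) (T : R -> R).
Context (b : 'I_N -> R) (p q : 'I_N -> nat).
Hypothesis hT : affine_markov_map c s T.
Hypothesis hB : branches c s T b p q.
Local Notation M := (transition_matrix N c T).

Section FixedGamma.
Context (gamma : R).
Hypothesis gamma_gt0 : 0 < gamma.
Hypothesis gamma_lt1 : gamma < 1.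
Local Notation phi := (phi T gamma).

Let gamma_ge0 : 0 <= gamma. Proof. exact: ltW. Qed.

Lemma phi_branch (i : 'I_N) x : c i < x < c i.+1 ->
  phi x = s i * x + b i + gamma * phi (s i * x + b i).
Proof.
move=> ix; rewrite -(branch_affine hB ix); apply: (phi_fun_eq hT) => //.
by apply: (atom01 hT (i := i)); rewrite atomE.
Qed.

(** One step back: the defects over the atoms of T(I_i) add up, and the branch
    of T over I_i pulls them back with a factor gamma. *)
Lemma phi_defect_growth (j : 'I_N) x y z :
  c j < x -> x < y -> y < z -> z < c j.+1 -> forall n (i : 'I_N),
  total_defect phi (c i) (c i.+1) (gamma ^+ n * (M ^+ n) i j * defect phi x y z).
Proof.
move=> jx xy yz zj; elim=> [|n IH] i.
  rewrite !expr0 mxE mul1r; have [->|ij] := eqVneq i j.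
    by rewrite mul1r; apply: TotalDefect1.
  by rewrite mul0r; apply: TotalDefect0; exact/ltW/(amm_incr hT).
pose w k := ext (fun l : 'I_N => gamma ^+ n * (M ^+ n) l j * defect phi x y z) k.
have dsum : total_defect phi (c (p i)) (c (q i)) (\sum_(p i <= k < q i) w k).
  apply: total_defect_sum => [|k /andP[_ kq]]; first exact: ltnW (branch_lt hB i).
  have kN := leq_trans kq (branch_leN hB i).
  by rewrite /w /ext (insubT (fun k => k < N)%N kN); exact: (IH (Ordinal kN)).
rewrite (_ : _ * defect _ _ _ _ = gamma * \sum_(p i <= k < q i) w k).
  apply: (total_defect_affine_pull (A := s i) (B := b i) (amm_slope hT i) _ dsum) => //.
    exact: branch_ends hB i.
  exact: phi_branch.
rewrite (sum_edge hB) [M ^+ _]exprS -mulmxE mxE exprS !mulr_sumr mulr_suml.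
by apply: eq_bigr => l _; ring.
Qed.

Lemma total_variation_atom (i : 'I_N) (f : R -> R) :
  (total_variation (c i) (c i.+1) f <= total_variation 0 1 f)%E.
Proof.
have /andP[c0 c1] := breakpoint01 hT (ltnW (ltn_ord i)).
have /andP[d0 d1] := breakpoint01 hT (ltn_ord i).
have cd := ltW (amm_incr hT i).
rewrite (total_variationD f c0 c1) (total_variationD f cd d1).
by rewrite addeCA leeDl// adde_ge0 ?total_variation_ge0.
Qed.

(** A positive defect in I_j bounds gamma^n (M^n)_ij for all n and i. From any
    atom I_l there is a path of some length k l to I_j, so gamma^n (M^n)_il is
    bounded as well, and so is gamma^n n_(n+1). *)
Lemma phi_defect0 : transitive_map N c T ->
  (total_variation 0 1 phi < +oo)%E ->
  (forall B, exists k, B < gamma ^+ k * (num_branches N c T k)%:R) ->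
  forall (j : 'I_N) x y z, c j < x -> x < y -> y < z -> z < c j.+1 ->
    defect phi x y z = 0.
Proof.
move=> htr tv_fin unbounded j x y z jx xy yz zj.
have tv_ge0 := total_variation_ge0 phi ler01.
set V := fine (total_variation 0 1 phi).
have VE : total_variation 0 1 phi = V%:E by rewrite fineK// ge0_fin_numE.
have d_ge0 : 0 <= defect phi x y z by rewrite /defect divr_ge0.
apply/eqP; rewrite eq_le d_ge0 andbT leNgt; apply/negP => d_gt0.
have V0 : 0 <= V by rewrite -lee_fin -VE.
have entry n i : gamma ^+ n * (M ^+ n) i j <= V / defect phi x y z.
  rewrite ler_pdivlMr// -lee_fin -VE.
  apply: le_trans (total_variation_atom i phi).
  exact/total_defect_le_variation/phi_defect_growth.
(* Entries of powers of M are natural numbers, so a positive one is >= 1. *)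
have /choice[k kP] : forall l, exists k, 1 <= (M ^+ k) l j.
  move=> l; have [k _ kpos] := htr l j; exists k.
  move: kpos; have /natrP[m ->] := mx_pow_nat hB k l j.
  by rewrite ltr0n ler1n.
pose K := \sum_(i < N) \sum_(l < N) V / defect phi x y z / gamma ^+ k l.
have K0 : 0 <= K.
  by apply: sumr_ge0 => i _; apply: sumr_ge0 => l _; rewrite !divr_ge0 ?exprn_ge0.
have total n : gamma ^+ n * (num_branches N c T n.+1)%:R <= K.
  rewrite (num_branchesS hT hB) mulr_sumr; apply: ler_sum => i _.
  rewrite mulr_sumr; apply: ler_sum => l _.
  rewrite ler_pdivlMr ?exprn_gt0//; apply: le_trans (entry (n + k l)%N i).
  rewrite mulrAC -exprD ler_wpM2l ?exprn_ge0// exprD -mulmxE mxE (bigD1 l)//=.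
  have sum0 : 0 <= \sum_(m | m != l) (M ^+ n) i m * (M ^+ k l) m j.
    by apply: sumr_ge0 => m _; rewrite mulr_ge0 ?(mx_pow_ge0 hB).
  apply: le_trans (_ : (M ^+ n) i l * (M ^+ k l) l j <= _); last by rewrite lerDl.
  by rewrite ler_peMr ?(mx_pow_ge0 hB).
have [n] := unbounded (1 + K); apply/negP; rewrite -leNgt.
case: n => [|n]; first by rewrite num_branches0 expr0 mul1r lerDl.
rewrite exprS -mulrA; apply: le_trans (_ : gamma * K <= _).
  by rewrite ler_wpM2l.
apply: le_trans (_ : K <= _); last by rewrite lerDr.
by rewrite ler_piMl// ltW.
Qed.

(** On I_i the equation phi = T + gamma * (phi o T) determines phi on T(I_i)
    from the affine formula on I_i. Comparing coefficients with the formula on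
    an atom I_j of T(I_i) gives these relations. *)
Lemma affine_pieces :
  (forall (j : 'I_N) x y z, c j < x -> x < y -> y < z -> z < c j.+1 ->
    defect phi x y z = 0) ->
  exists al be : 'I_N -> R, forall i j, edge p q i j ->
    al i = s i * (1 + gamma * al j) /\
    be i = b i * (1 + gamma * al j) + gamma * be j.
Proof.
move=> d0.
have /choice[al /choice[be phiE]] : forall i : 'I_N, exists A B,
    forall x, c i < x < c i.+1 -> phi x = A * x + B.
  by move=> i; apply: defect0_affine (amm_incr hT i) _; exact: d0.
exists al, be => i j ij.
have cj := amm_incr hT j; have s0 := amm_slope hT i.
have val y : c j < y < c j.+1 -> let x := (y - b i) / s i in
    al i * x + be i =
    s i * (1 + gamma * al j) * x + (b i * (1 + gamma * al j) + gamma * be j).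
  move=> jy /=; have : atom c j y by rewrite atomE.
  move/(proj1 (edgeP hB i j) ij) => [x ix xy]; move: ix; rewrite atomE => ix.
  have yE : y = s i * x + b i by rewrite -xy (branch_affine hB ix).
  have -> : (y - b i) / s i = x by rewrite yE addrK mulrC mulKf.
  rewrite -(phiE _ _ ix) (phi_branch ix) -yE (phiE _ _ jy) yE; ring.
pose y1 := c j + (c j.+1 - c j) / 3; pose y2 := c j + 2 * (c j.+1 - c j) / 3.
have v1 : c j < y1 < c j.+1 by rewrite /y1; lra.
have v2 : c j < y2 < c j.+1 by rewrite /y2; lra.
apply: affine_coef_unique (val _ v1) (val _ v2).
rewrite (inj_eq (mulIf _)) ?invr_eq0// (inj_eq (addIr _)) lt_eqF// /y1 /y2; lra.
Qed.

End FixedGamma.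

(** The end of an atom is a pair of the atom and a boolean, true for the right
    end. The two ends meeting at a breakpoint are kept apart, since T and phi
    may have different one-sided limits there. *)
Definition end_pos (a : 'I_N * bool) : R := if a.2 then c a.1.+1 else c a.1.

Let first_lt i : (p i < N)%N.
Proof. exact: leq_trans (branch_lt hB i) (branch_leN hB i). Qed.

Let last_lt i : ((q i).-1 < N)%N.
Proof.
by rewrite (leq_trans _ (branch_leN hB i))// prednK// (leq_trans _ (branch_lt hB i)).
Qed.

Definition first_atom i : 'I_N := Ordinal (first_lt i).
Definition last_atom i : 'I_N := Ordinal (last_lt i).

(** The one-sided limit of T at an end of I_i is an end of T(I_i), seen as the
    end of its first or last atom. *)
Definition end_image (a : 'I_N * bool) : 'I_N * bool :=
  if a.2 == (0 < s a.1) then (last_atom a.1, true) else (first_atom a.1, false).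

Lemma edge_first i : edge p q i (first_atom i).
Proof. by rewrite /edge /= leqnn (branch_lt hB). Qed.

Lemma edge_last i : edge p q i (last_atom i).
Proof. by rewrite /edge /=; have := branch_lt hB i; lia. Qed.

Lemma edge_end_image a : edge p q a.1 (end_image a).1.
Proof. by rewrite /end_image; case: ifP => _; [exact: edge_last|exact: edge_first]. Qed.

Lemma pos_first i : end_pos (first_atom i, false) = c (p i). Proof. by []. Qed.

Lemma pos_last i : end_pos (last_atom i, true) = c (q i).
Proof. by rewrite /end_pos /= prednK// (leq_trans _ (branch_lt hB i)). Qed.

Lemma end_pos_image a : end_pos (end_image a) = s a.1 * end_pos a + b a.1.
Proof.
case: a => i [] /=; rewrite /end_image /=; have := branch_ends hB i;
  case: ifP => _ [e1 e2]; by rewrite /= ?pos_first ?pos_last /end_pos /= ?e1 ?e2.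
Qed.

(** The coefficients of the linear form which vanishes on X when the points
    (end_pos u, X u) lie on a line, for the three ends u consisting of the two
    ends of the image of I_i and the right end of its first atom. *)
Definition bend i : seq (R * ('I_N * bool)) :=
  let x := (last_atom i, true) in
  let y := (first_atom i, false) in let z := (first_atom i, true) in
  [:: (end_pos y - end_pos z, x); (end_pos z - end_pos x, y); (end_pos x - end_pos y, z)].

Lemma bend_eq0 i (X : 'I_N * bool -> R) :
  \sum_(u <- bend i) u.1 * X u.2 = 0 ->
  let x := (last_atom i, true) in
  let y := (first_atom i, false) in let z := (first_atom i, true) in
  (X x - X y) * (end_pos z - end_pos y) = (X z - X y) * (end_pos x - end_pos y).
Proof. rewrite /bend !big_cons big_nil /=; lra. Qed.

(** If all these forms vanished on the positions X k of the k-th images of the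
    ends, then X k would be affine on the three ends of each image. Hence
    X (k + 1) stretches I_i by |s_i| times the factor by which X k stretches
    the first atom of T(I_i): the distance of the images of two ends of an atom
    would grow exponentially. *)
Lemma bend_nonzero : expanding s -> exists i k,
  \sum_(u <- bend i) u.1 * end_pos (end_image (iter k end_image u.2)) != 0.
Proof.
move=> hexp; apply: contrapT => none.
pose X k a := end_pos (iter k end_image a).
have bend0 i k : \sum_(u <- bend i) u.1 * X k u.2 = 0.
  case: k => [|k]; first by rewrite /bend !big_cons big_nil /X /=; ring.
  by apply/eqP/negP => /negP h; apply: none; exists i, k.
have [sg sg1 sg_le] : exists2 sg, 1 < sg & forall i, sg <= `|s i|.
  exists (\big[Num.min/2]_i `|s i|); last by move=> i; exact: bigmin_le.
  by apply: lt_bigmin => [|i _]; [rewrite ltr1n|exact: hexp].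
have sg0 : 0 <= sg by lra.
have grow k (i : 'I_N) : sg ^+ k * (c i.+1 - c i) <= `|X k (i, true) - X k (i, false)|.
  elim: k i => [|k IH] i.
    by rewrite expr0 mul1r /X /end_pos /= ler_norm.
  have cc := amm_incr hT i; set P := first_atom i.
  have cP : 0 < end_pos (P, true) - end_pos (P, false) by rewrite subr_gt0; exact: amm_incr hT P.
  have -> : `|X k.+1 (i, true) - X k.+1 (i, false)|
      = `|X k (last_atom i, true) - X k (P, false)|.
    rewrite /X !iterSr /end_image /=; case: (0 < s i) => //=; by rewrite distrC.
  have len : `|end_pos (last_atom i, true) - end_pos (P, false)| = `|s i| * (c i.+1 - c i).
    rewrite -[in RHS](gtr0_norm (_ : 0 < c i.+1 - c i)) ?subr_gt0// -normrM.
    have p1 := end_pos_image (i, true); have p0 := end_pos_image (i, false).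
    have -> : s i * (c i.+1 - c i) = end_pos (end_image (i, true)) - end_pos (end_image (i, false)).
      by rewrite p1 p0 /end_pos /=; ring.
    by rewrite /end_image /=; case: (0 < s i) => //=; rewrite distrC.
  have /= rel := bend_eq0 (bend0 i k).
  rewrite -(ler_pM2r cP) -[X in _ <= _ * X](gtr0_norm cP) -normrM rel normrM len.
  set D := end_pos (P, true) - end_pos (P, false) in cP *.
  have IHP : sg ^+ k * D <= `|X k (P, true) - X k (P, false)| := IH P.
  have L0 : 0 <= c i.+1 - c i by rewrite subr_ge0 ltW.
  rewrite (_ : _ * D = sg ^+ k * D * (sg * (c i.+1 - c i))); last first.
    by rewrite exprS; ring.
  apply: ler_pM => //; rewrite ?mulr_ge0 ?exprn_ge0 ?(ltW cP)//.
  by rewrite ler_wpM2r.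
have N0 := num_atoms_gt0 hT; pose i0 : 'I_N := Ordinal N0.
have c0 := amm_incr hT i0.
(* The linear growth of sg ^ k is enough for a contradiction. *)
have bernoulli k : k%:R * (sg - 1) <= sg ^+ k.
  elim: k => [|k IH]; first by rewrite mul0r.
  have : 1 <= sg ^+ k by rewrite exprn_ege1// ltW.
  rewrite exprS -natr1 => one; have := ler_wpM2l (_ : 0 <= sg - 1) one; nra.
have pos01 a : 0 <= end_pos a <= 1.
  case: a => i [] /=; rewrite /end_pos /=; apply: (breakpoint01 hT) => //.
  exact: ltnW.
have d0 : 0 < (sg - 1) * (c i0.+1 - c i0) by rewrite mulr_gt0 ?subr_gt0.
have /archi_boundP : 0 <= 1 / ((sg - 1) * (c i0.+1 - c i0)) by rewrite divr_ge0// ltW.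
set k := Num.bound _; rewrite ltr_pdivrMr// mulrA => big.
have := grow k i0; apply/negP; rewrite -ltNge.
apply: (@le_lt_trans _ _ 1).
  have := pos01 (iter k end_image (i0, true)); have := pos01 (iter k end_image (i0, false)).
  by rewrite -/(X k (i0, true)) -/(X k (i0, false)) => ? ?; rewrite ler_norml; lra.
apply: lt_le_trans big _; rewrite ler_wpM2r//; first by rewrite subr_ge0 ltW.
Qed.

Lemma affine_pieces_at_ends (gamma : R) (al be : 'I_N -> R) :
  0 < gamma ->
  (forall i j, edge p q i j -> al i = s i * (1 + gamma * al j) /\
    be i = b i * (1 + gamma * al j) + gamma * be j) ->
  let U a := al a.1 * end_pos a + be a.1 in
  (forall a, U a = end_pos (end_image a) + gamma * U (end_image a)) /\
  (forall i, \sum_(u <- bend i) u.1 * U u.2 = 0).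
Proof.
move=> gamma0 rec U; split=> [a|i].
  have [aE bE] := rec _ _ (edge_end_image a).
  by rewrite /U aE bE end_pos_image; ring.
have [a1 b1] := rec _ _ (edge_first i); have [a2 b2] := rec _ _ (edge_last i).
have gn0 : gamma != 0 by rewrite gt_eqF.
have aE : al (last_atom i) = al (first_atom i).
  apply: (mulfI gn0); apply: (addrI 1).
  by apply: (mulfI (amm_slope hT i)); rewrite -a1 -a2.
have bE : be (last_atom i) = be (first_atom i).
  apply: (mulfI gn0).
  by apply: (addrI (b i * (1 + gamma * al (first_atom i)))); rewrite -b1 -aE -b2.
by rewrite /bend !big_cons big_nil /U /= aE bE; ring.
Qed.

End Lower.

Theorem theorem1 (R : realType) (N : nat) (c : nat -> R) (s : 'I_N -> R)
    (T : R -> R) (hT : affine_markov_map c s T) (hexp : expanding s)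
    (htr : transitive_map N c T) :
  (forall gamma : R, 0 < gamma -> gamma < 1 ->
     expR (htop N c T) * gamma < 1 ->
     (total_variation 0 1 (phi T gamma) < +oo)%E) /\
  (exists E : seq R, (size E <= 2 * N - 1)%N /\
     forall gamma : R, 0 < gamma -> gamma < 1 ->
       1 < expR (htop N c T) * gamma -> gamma \notin E ->
       total_variation 0 1 (phi T gamma) = +oo%E).
Proof.
have [b [p [q hB]]] := branches_exist hT.
have u_ge1 := num_branches_ge1 hT hB.
have u_sub := num_branches_submult hT hB.
split=> [gamma g0 g1 small|].
  have [C [r [C0 r0 r1 decay]]] := submult_decay u_ge1 u_sub g0 small.
  set u1 := (num_branches N c T 1)%:R : R.
  have u10 : 0 <= u1 by apply: le_trans (u_ge1 1%N).
  apply: (phi_bounded_variation hT hB g0 g1 (B := u1 * C / (1 - r))) => n.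
  apply: (@le_trans _ _ (\sum_(l < n) u1 * C * r ^+ l)).
    apply: ler_sum => l _; rewrite -mulrA; apply: le_trans (_ : u1 * (gamma ^+ l * (num_branches N c T l)%:R) <= _).
      rewrite mulrCA ler_wpM2l ?exprn_ge0 ?(ltW g0)// -addn1 mulrC; exact: u_sub.
    by rewrite ler_wpM2l.
  rewrite -mulr_sumr ler_wpM2l ?mulr_ge0//.
  rewrite -[leRHS]mul1r ler_pdivlMr ?subr_gt0// mulrC.
  by rewrite -opprB mulNr -subrX1 opprB lerBlDr lerDl exprn_ge0// ltW.
have [i [k bend_ik]] := bend_nonzero hT hB hexp.
have [E [sE Eroot]] :=
  linear_relation_finite (g := end_image hB) (xi := end_pos c \o end_image hB) bend_ik.
exists E; split; first by rewrite card_prod card_ord card_bool mulnC in sE.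
move=> gamma g0 g1 large; apply: contraNeq; rewrite -ltey => tv_fin.
have unbounded := submult_unbounded u_ge1 u_sub g0 large.
have [al [be rec]] := affine_pieces hT hB g0 g1
  (phi_defect0 hT hB g0 g1 htr tv_fin unbounded).
have [Ueq Ubend] := affine_pieces_at_ends hT hB g0 rec.
exact: Eroot Ueq (Ubend i).
Qed.
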